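(* If $G$ is a graph with minimum degree $\delta=\delta(G)\ge 1$ and maximum degree $\Delta=\Delta(G)\ge 4\lceil\delta/2\rceil-3$, then $$\mathrm{DC}(G)\le \Big\lceil\tfrac{\delta}{2}\Big\rceil\Big(\Delta-2\Big\lceil\tfrac{\delta}{2}\Big\rceil+2\Big)+1+\Big\lfloor\tfrac{\delta}{2}\Big\rfloor.$$ Moreover, the bound is sharp: for every odd $\delta\ge 3$ there exist graphs with minimum degree $\delta$ satisfying the hypothesis and attaining equality.
   Context: All graphs are finite, simple and connected. $N[v]=N(v)\cup\{v\}$ denotes the closed neighborhood of $v$. For a graph $G$ with $\delta(G)\ge 1$, a set $S\subseteq V(G)$ is a double dominating set if $|N[v]\cap S|\ge 2$ for every $v\in V(G)$. Two disjoint sets $U,W\subseteq V(G)$ form a double coalition if neither is a double dominating set but $U\cup W$ is. A double coalition partition of $G$ is a partition $\Omega$ of $V(G)$ in which every set forms a double coalition with some other set of $\Omega$. The double coalition number $\mathrm{DC}(G)$ is the maximum cardinality of a double coalition partition of $G$. *)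

(* Defs.v *)
From mathcomp Require Import all_boot.
Set Implicit Arguments. Unset Strict Implicit. Unset Printing Implicit Defensive.

Section Graph.
Variables (T : finType) (e : rel T).

Definition simple_graph : Prop := symmetric e /\ irreflexive e.
Definition connected_graph : Prop := forall x y : T, connect e x y.

Definition nbhd (v : T) : {set T} := [set u | e v u].
Definition cnbhd (v : T) : {set T} := v |: nbhd v.
Definition deg (v : T) : nat := #|nbhd v|.

(* minimum / maximum degree (for nonempty T; degrees are < #|T|) *)
Definition mindeg : nat := \big[minn/#|T|]_(v : T) deg v.
Definition maxdeg : nat := \max_(v : T) deg v.

Definition double_dom (S : {set T}) : bool :=
  [forall v, 2 <= #|cnbhd v :&: S|].

Definition double_coalition (U W : {set T}) : bool :=
  [&& [disjoint U & W], ~~ double_dom U, ~~ double_dom W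
    & double_dom (U :|: W)].

Definition double_coalition_partition (P : {set {set T}}) : bool :=
  partition P [set: T] &&
  [forall U in P, exists W in P, (W != U) && double_coalition U W].

Definition DC : nat :=
  \max_(P : {set {set T}} | double_coalition_partition P) #|P|.
End Graph.

Definition dc_bound (d D : nat) : nat :=
  uphalf d * (D + 2 - 2 * uphalf d) + 1 + d./2.

(* Main.v *)
Require Import Defs.
From mathcomp Require Import all_boot zify.

(** Let [v] have minimum degree. A class missing [N[v]] ("light") can only be in
coalition with a class meeting [N[v]] at least twice ("heavy"). Choose a minimal
family [H] of heavy classes in which every light class has a partner, and put
[h := #|H|]; by minimality each [B] in [H] has a light partner [C_B] private to it.
If [A] in [H] is not doubly dominating at [u], then inside [N[u]] every other [B]
in [H] uses, together with [C_B], two vertices, while each light partner of [A]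
uses at least one, so [A] has at most [Delta - 2h + 2] light partners. Since at
most [delta + 1 - h] classes meet [N[v]], the partition has at most
[h (Delta - 2h + 2) + delta + 1 - h] classes, and the hypothesis on [Delta] makes
this nondecreasing in [h <= uphalf delta]. *)

Set Implicit Arguments. Unset Strict Implicit. Unset Printing Implicit Defensive.

(** * Minimum degree and counting along a partition *)

Section Degrees.
Variables (T : finType) (e : rel T).

Lemma bigmin_seq_le (I : eqType) (r : seq I) (F : I -> nat) m v :
  v \in r -> \big[minn/m]_(i <- r) F i <= F v.
Proof.
elim: r => // x r IH; rewrite inE big_cons => /orP[/eqP-> | /IH]; first exact: geq_minl.
exact: leq_trans (geq_minr _ _).
Qed.

Lemma mindeg_le v : mindeg e <= deg e v.
Proof. by apply: bigmin_seq_le; rewrite mem_index_enum. Qed.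

Lemma le_mindeg m : m <= #|T| -> (forall v, m <= deg e v) -> m <= mindeg e.
Proof.
move=> mT mdeg; rewrite /mindeg.
by elim/big_ind: _ => // x y mx my; rewrite leq_min mx my.
Qed.

(** Positivity excludes the empty graph, where the iterated minimum takes its start value
    [#|T| = 0]. *)
Lemma mindeg_witness : 0 < mindeg e -> exists v, deg e v = mindeg e.
Proof.
have [x _ | T0] := pickP (@predT T); last first.
  by rewrite /mindeg big_pred0 // (eq_card0 T0).
have [v _ vmin] := arg_minnP (deg e) (isT : predT x).
exists v; apply/eqP; rewrite eqn_leq mindeg_le andbT le_mindeg ?max_card //.
by move=> w; exact: vmin.
Qed.

Lemma card_cnbhd v : irreflexive e -> #|cnbhd e v| = (deg e v).+1.
Proof. by move=> irr; rewrite /cnbhd cardsU1 inE irr. Qed.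

Lemma sum_card_setI_partition (P : {set {set T}}) (X : {set T}) :
  partition P [set: T] -> \sum_(A in P) #|X :&: A| = #|X|.
Proof.
move=> partP; rewrite -[RHS]sum1_card [RHS]big_mkcond /=.
rewrite [RHS](eq_bigl (fun x => x \in [set: T])); last by move=> x; rewrite in_setT.
rewrite (set_partition_big _ partP); apply: eq_bigr => A _.
rewrite -sum1_card -big_mkcondr; apply: eq_bigl => x.
by rewrite inE andbC.
Qed.

End Degrees.

(** The two products differ by [(k - h) * (D + 2 - 2 * h - 2 * k)]. For [h < k] the hypothesis makes
    the second factor at least 1, so the difference is at least [k - h]. *)
Lemma bound_step (h k D : nat) :
  h <= k -> 4 * k - 3 <= D ->
  h * (D + 2 - 2 * h) + k <= k * (D + 2 - 2 * k) + h.
Proof.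
move=> hk kD; have [->|hNk] := eqVneq h k; first by rewrite leqnn.
have ltk : h < k by rewrite ltn_neqAle hNk.
have [t Et] : exists t, k = h + t.+1 by exists (k - h).-1; lia.
have [s Es] : exists s, D + 2 = 2 * k + 2 * h + s.+1.
  by exists (D + 2 - 2 * k - 2 * h).-1; lia.
have -> : D + 2 - 2 * h = 2 * k + s.+1 by lia.
have -> : D + 2 - 2 * k = 2 * h + s.+1 by lia.
by rewrite Et; nia.
Qed.

(** * The upper bound *)

Section UpperBound.
Variables (T : finType) (e : rel T) (P : {set {set T}}) (v : T).
Hypotheses (irr : irreflexive e) (dcP : double_coalition_partition e P).

Let w (u : T) (A : {set T}) : nat := #|cnbhd e u :&: A|.
Let light : {set {set T}} := [set C in P | w v C == 0].
Let heavy : {set {set T}} := [set A in P | 2 <= w v A].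
Let partners (A : {set T}) : {set {set T}} :=
  [set C in light | double_coalition e C A].

Let covering (H : {set {set T}}) : bool :=
  (H \subset heavy) && [forall C in light, exists A in H, double_coalition e C A].

Let partP : partition P [set: T]. Proof. by case/andP: dcP. Qed.

Let sum_w u : \sum_(A in P) w u A = (deg e u).+1.
Proof. by rewrite sum_card_setI_partition // card_cnbhd. Qed.

Lemma coalition_weight u (A B : {set T}) :
  double_coalition e A B -> 2 <= w u A + w u B.
Proof.
case/and4P=> dAB _ _ /forallP/(_ u); rewrite setIUr cardsU => le2.
by rewrite /w; apply: leq_trans le2 (leq_subr _ _).
Qed.

Lemma covering_heavy : covering heavy.
Proof.
rewrite /covering subxx /=; apply/forall_inP=> C Clight.
move: (Clight); rewrite inE => /andP[CP /eqP C0].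
case/andP: dcP => _ /forall_inP/(_ C CP)/exists_inP[A AP /andP[_ CA]].
apply/exists_inP; exists A => //; rewrite inE AP /=.
by have := coalition_weight v CA; rewrite C0.
Qed.

Section MinimalCover.
Variable H : {set {set T}}.
Hypothesis minH : minset covering H.

Let covH : covering H. Proof. exact: minsetp minH. Qed.
Let HsubP : {subset H <= P}.
Proof. by case/andP: covH => /subsetP sub _ A /sub; rewrite inE => /andP[]. Qed.
Let H_heavy A : A \in H -> 2 <= w v A.
Proof. by case/andP: covH => /subsetP sub _ /sub; rewrite inE => /andP[]. Qed.

(** By minimality, [H :\ A] leaves some light class without a partner; the partner that this class
    has in [H] can only be [A]. *)
Lemma private_partner A : A \in H ->
  exists2 C, C \in partners A &
    forall B, B \in H -> double_coalition e C B -> B = A.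
Proof.
move=> AH; have : ~~ covering (H :\ A).
  apply/negP=> covA; have := minsetinf minH covA (subsetDl _ _).
  by move=> /setP/(_ A); rewrite !inE eqxx AH.
have /andP[Hheavy /forall_inP coverH] := covH.
rewrite negb_and (subset_trans (subsetDl _ _) Hheavy) /=.
case/forall_inPn=> C Clight /exists_inPn noB.
have only B : B \in H -> double_coalition e C B -> B = A.
  move=> BH CB; apply/eqP/negPn/negP=> BA.
  by have := noB B; rewrite !inE BA BH CB => /(_ isT).
have [B BH CB] := exists_inP (coverH C Clight).
by exists C => //; rewrite inE Clight -(only B BH CB).
Qed.

Lemma card_partners A : A \in H -> #|partners A| + 2 * #|H| <= maxdeg e + 2.
Proof.
move=> AH.
have [C0 C0A _] := private_partner AH.
have /and4P[_ _ Anot _] : double_coalition e C0 A.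
  by move: C0A; rewrite inE => /andP[].
have {Anot} [u wA] : exists u, w u A <= 1.
  by case/forallPn: Anot => u; rewrite -ltnNge ltnS; exists u.
(* The informative form yields a choice function [priv]; [set0] is a dummy value outside [H]. *)
have privP B : {C | B \in H -> C \in partners B /\
    forall B', B' \in H -> double_coalition e C B' -> B' = B}.
  case: (boolP (B \in H)) => [BH | _]; last by exists set0.
  suff: exists C, (C \in partners B) &&
      [forall (B' | B' \in H), double_coalition e C B' ==> (B' == B)].
    move/sigW=> [C /andP[CB /forall_inP only]]; exists C => _; split=> //.
    by move=> B' B'H /(implyP (only B' B'H))/eqP.
  have [C CB only] := private_partner BH; exists C; rewrite CB /=.
  by apply/forall_inP=> B' B'H; apply/implyP=> /(only _ B'H)->.
pose priv B := sval (privP B).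
have priv_in B : B \in H -> priv B \in partners B.
  by move=> BH; case: (svalP (privP B) BH).
have priv_only B B' : B \in H -> B' \in H ->
    double_coalition e (priv B) B' -> B' = B.
  by move=> BH B'H; case: (svalP (privP B) BH) => _; apply.
have privDC B : B \in H -> double_coalition e (priv B) B.
  by move/priv_in; rewrite inE => /andP[].
have priv_inj : {in H :\ A &, injective priv}.
  move=> B B' /setD1P[_ BH] /setD1P[_ B'H] eqp.
  by apply: priv_only (B'H) (BH) _; rewrite -eqp; exact: privDC.
pose Q := priv @: (H :\ A).
have QsubL : {subset Q <= light}.
  move=> C /imsetP[B /setD1P[_ BH] ->].
  by have := priv_in B BH; rewrite inE => /andP[].
have lightP : {subset light <= P} by move=> C; rewrite inE => /andP[].
have disHL C : C \in H -> C \in light -> False.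
  by move=> /H_heavy w2; rewrite inE => /andP[_ /eqP w0]; rewrite w0 in w2.
have disQ C : C \in Q -> C \in partners A -> False.
  move=> /imsetP[B /setD1P[BA BH] ->]; rewrite inE => /andP[_ dcA].
  by rewrite (priv_only B A BH AH dcA) eqxx in BA.
have sumH : \sum_(B in H) w u B = w u A + \sum_(B in H :\ A) w u B.
  by rewrite (big_setD1 A).
have sumQ : \sum_(C in Q) w u C = \sum_(B in H :\ A) w u (priv B).
  by rewrite big_imset.
have pairs : 2 * (#|H|).-1 <= \sum_(B in H :\ A) w u B + \sum_(C in Q) w u C.
  rewrite sumQ -big_split /= mulnC.
  have -> : #|H|.-1 = #|H :\ A| by rewrite (cardsD1 A H) AH.
  rewrite -sum_nat_const; apply: leq_sum => B /setD1P[_ BH].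
  by rewrite addnC; apply: coalition_weight; exact: privDC.
have sumA : #|partners A| * (2 - w u A) <= \sum_(C in partners A) w u C.
  rewrite -sum_nat_const; apply: leq_sum => C; rewrite inE => /andP[_ CA].
  by rewrite leq_subLR addnC; exact: coalition_weight.
(* [H], [Q] and [partners A] are pairwise disjoint subfamilies of [P], so together they meet the
   closed neighbourhood of [u] in at most [deg e u + 1] vertices. *)
have total : \sum_(B in H) w u B + \sum_(C in Q) w u C
    + \sum_(C in partners A) w u C <= (deg e u).+1.
  rewrite -sum_w [X in X + _ + _]big_mkcond [X in _ + X + _]big_mkcond.
  rewrite [X in _ + X]big_mkcond [leqRHS]big_mkcond -!big_split /=.
  apply: leq_sum => C _; move: (@HsubP C) (QsubL C) (lightP C) (disHL C) (disQ C).
  have : C \in partners A -> C \in light by rewrite inE => /andP[].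
  case: (C \in H); case: (C \in Q); case: (C \in partners A);
    case: (C \in light); case: (C \in P); try (move=> *; lia); by do ?[move/(_ isT)].
have A1 : 0 < #|partners A| by apply/card_gt0P; exists C0.
have H1 : 0 < #|H| by apply/card_gt0P; exists A.
have dD : deg e u <= maxdeg e by exact: leq_bigmax.
(* If [w u A] is 1, the count is exactly the claim. If it is 0, every partner weighs at least 2, and
   [A1] makes up for the missing unit. *)
move: wA sumA total; rewrite sumH; case: (w u A) => [|[|//]] _; lia.
Qed.

Lemma card_light : #|light| <= #|H| * (maxdeg e + 2 - 2 * #|H|).
Proof.
have sub : light \subset \bigcup_(A in H) partners A.
  apply/subsetP=> C Cl; have /andP[_ /forall_inP/(_ C Cl)/exists_inP[A AH CA]] := covH.
  by apply/bigcupP; exists A => //; rewrite inE Cl.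
apply: leq_trans (subset_leq_card sub) _.
rewrite -sum_nat_const; elim/big_rec2: _ => [|A m X AH le_m]; first by rewrite cards0.
apply: leq_trans (leq_card_setU _ _).1 _; apply: leq_add le_m.
by have := card_partners AH; lia.
Qed.

(** Each class that is not light takes a vertex of the closed neighbourhood of [v], and each class
    of [H] takes a second one. *)
Lemma card_nonlight : #|P :\: light| + #|H| <= (deg e v).+1.
Proof.
rewrite -(sum_w v) -!sum1_card.
rewrite [X in X + _]big_mkcond [X in _ + X]big_mkcond [leqRHS]big_mkcond -big_split /=.
apply: leq_sum => A _; have := @HsubP A; have := @H_heavy A.
rewrite !inE; case: (A \in H); case: (A \in P) => //=;
  case: (w v A) => [|[|m]] //=; try lia; by do ?[move/(_ isT)].
Qed.

Lemma card_le_minimal_cover : 4 * uphalf (deg e v) - 3 <= maxdeg e ->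
  #|P| <= dc_bound (deg e v) (maxdeg e).
Proof.
move=> dD.
have nl := card_nonlight; have l := card_light.
have HnL : #|H| <= #|P :\: light|.
  apply/subset_leq_card/subsetP=> A AH; rewrite !inE (HsubP AH) /= andbT.
  by have := H_heavy AH; case: (w v A).
have ED : uphalf (deg e v) + (deg e v)./2 = deg e v.
  by rewrite uphalf_half -addnA addnn odd_double_half.
(* [nl] and [HnL] give [2 * #|H| <= deg e v + 1]. *)
have hk : #|H| <= uphalf (deg e v) by move: ED nl HnL; rewrite uphalf_half; lia.
have := bound_step hk dD.
have -> : #|P| = #|light| + #|P :\: light|.
  rewrite -(cardsID light P); congr (_ + _); apply: eq_card => C.
  by rewrite !inE; case: (C \in P).
rewrite /dc_bound; lia.
Qed.

End MinimalCover.
End UpperBound.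

Lemma DC_le (T : finType) (e : rel T) :
  simple_graph e -> 1 <= mindeg e -> 4 * uphalf (mindeg e) - 3 <= maxdeg e ->
  DC e <= dc_bound (mindeg e) (maxdeg e).
Proof.
move=> [_ irr] d1 dD; have [v Ev] := mindeg_witness d1.
apply/bigmax_leqP=> P dcP; rewrite -Ev in d1 dD *.
have [H minH _] := minset_exists (covering_heavy v dcP).
exact: (card_le_minimal_cover irr dcP minH).
Qed.

(** * Transport along a bijection, and partitions given by colourings *)

Section Relabelling.
Variables (T T' : finType) (e : rel T) (g : T' -> T).
Hypothesis bij_g : bijective g.

Lemma card_preimset_bij (A : {set T}) : #|g @^-1: A| = #|A|.
Proof. by apply: on_card_preimset; apply: onW_bij. Qed.

Lemma deg_relpre x : deg (relpre g e) x = deg e (g x).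
Proof.
by rewrite /deg -[RHS]card_preimset_bij; apply: eq_card => y; rewrite !inE.
Qed.

Lemma double_dom_relpre (A : {set T}) :
  double_dom (relpre g e) (g @^-1: A) = double_dom e A.
Proof.
have Ecard x : #|cnbhd (relpre g e) x :&: g @^-1: A| = #|cnbhd e (g x) :&: A|.
  rewrite -[RHS]card_preimset_bij; apply: eq_card => y.
  by rewrite !inE (bij_eq bij_g).
case: (bij_g) => h _ hK; apply/forallP/forallP=> dom x; last by rewrite Ecard.
by have := dom (h x); rewrite Ecard hK.
Qed.

Lemma connected_relpre : connected_graph e -> connected_graph (relpre g e).
Proof.
case: (bij_g) => h gK hK conn x y.
have /connectP[s es Ey] := conn (g x) (g y).
suff conn_h z : path e z s -> connect (relpre g e) (h z) (h (last z s)).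
  by have := conn_h _ es; rewrite -Ey !gK.
elim: s z {es Ey} => //= u s IH z /andP[ezu /IH].
by apply: connect_trans; apply: connect1; rewrite /= !hK.
Qed.

End Relabelling.

(** The fibres of [f] form the partition; surjectivity makes them nonempty and pairwise distinct, so
    there are [#|K|] of them. *)
Lemma colouring_le_DC (T K : finType) (e : rel T) (f : T -> K) :
  (forall c, exists x, f x = c) ->
  (forall c, ~~ double_dom e (f @^-1: [set c])) ->
  (forall c, exists2 c', c' != c &
     double_dom e (f @^-1: [set c] :|: f @^-1: [set c'])) ->
  #|K| <= DC e.
Proof.
move=> f_surj f_not f_dom; pose F c := f @^-1: [set c].
have FP c x : (x \in F c) = (f x == c) by rewrite !inE.
have F_inj : injective F.
  move=> c c' EF; have [x fx] := f_surj c.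
  by have := FP c x; rewrite EF FP fx eqxx => /eqP.
rewrite -(card_imset predT F_inj).
apply: (leq_bigmax_cond (F := fun P : {set {set T}} => #|P|)).
rewrite /double_coalition_partition; apply/andP; split.
  apply/and3P; split.
  - apply/eqP/setP=> x; rewrite inE; apply/bigcupP; exists (F (f x)).
      exact: imset_f.
    by rewrite FP.
  - apply/trivIsetP=> _ _ /imsetP[c _ ->] /imsetP[c' _ ->] neq.
    rewrite -setI_eq0; apply/eqP/setP=> x; rewrite inE !FP inE.
    by apply/negP=> /andP[/eqP-> /eqP Ec]; rewrite Ec eqxx in neq.
  - apply/imsetP=> -[c _ E0]; have [x fx] := f_surj c.
    by have := FP c x; rewrite -E0 inE fx eqxx.
apply/forall_inP=> _ /imsetP[c _ ->]; have [c' neq dom] := f_dom c.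
apply/exists_inP; exists (F c'); first exact: imset_f.
rewrite (inj_eq F_inj) neq /=; apply/and4P; split; [|exact: f_not|exact: f_not|exact: dom].
rewrite -setI_eq0; apply/eqP/setP=> x; rewrite inE !FP inE.
by apply/negP=> /andP[/eqP-> /eqP Ec]; rewrite Ec eqxx in neq.
Qed.

(** * The extremal graphs *)

Section Extremal.
Variables k p : nat.

(* [(i, j, None)] is a hub and the [(i, j, Some (x, s))] are its core, a complete
   graph on [2 * k] vertices. The hubs with the same [i] form a clique and a hub
   sees its whole core except [(i, true)], so the colour class of [(i, None)]
   meets its closed neighbourhood only once. The links between the core vertices
   [(i, false)] with the same [j] serve only to make the graph connected. *)
Definition ext_vertex : finType := ('I_k * 'I_p * option ('I_k * bool))%type.

Definition ext_adj : rel ext_vertex := fun a b =>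
  match a, b with
  | (i, j, None), (i', j', None) => (i == i') && (j != j')
  | (i, j, None), (i', j', Some xs)
  | (i', j', Some xs), (i, j, None) =>
      [&& i == i', j == j' & xs != (i, true)]
  | (i, j, Some xs), (i', j', Some xs') =>
      ((i == i') && (j == j') && (xs != xs'))
      || [&& i != i', j == j', xs == (i, false) & xs' == (i', false)]
  end.

(** Each hub is a class by itself, while [(x, None)] takes two vertices from every core. Seen from a
    vertex [(i, j, Some (i, true))], the hub classes are light and the [k] others heavy, each of
    these having [p] light partners. *)
Definition ext_colour (a : ext_vertex) : 'I_k * option 'I_p :=
  match a with
  | (i, j, None) => (i, Some j)
  | (_, _, Some (x, _)) => (x, None)
  end.

Lemma ext_adj_sym : symmetric ext_adj.
Proof.
move=> [[i j] [xs|]] [[i' j'] [xs'|]] //=.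
  by rewrite ![_ == i']eq_sym ![_ == j']eq_sym ![_ == xs']eq_sym;
     congr (_ || _); congr (_ && _); congr (_ && _); rewrite andbC.
by rewrite [i == _]eq_sym [j == _]eq_sym.
Qed.

Lemma ext_adj_irr : irreflexive ext_adj.
Proof. by move=> [[i j] [xs|]] /=; rewrite !eqxx. Qed.

(** Every vertex reaches [(i, false)] in its own core; the links then change [i], and the hub
    cliques change [j]. *)
Lemma ext_connected : connected_graph ext_adj.
Proof.
have csym : connect_sym ext_adj by apply: sym_connect_sym; exact: ext_adj_sym.
have to_core i j o : connect ext_adj (i, j, o) (i, j, Some (i, false)).
  have [-> //|neq] := eqVneq o (Some (i, false)).
  by apply: connect1; case: o neq => [xs|] //= neq; rewrite !eqxx ?xpair_eqE ?andbF //= neq.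
have core i i' j : connect ext_adj (i, j, Some (i, false)) (i', j, Some (i', false)).
  have [-> //|neq] := eqVneq i i'.
  by apply: connect1; rewrite /= !eqxx neq /= orbT.
have hub i j j' : connect ext_adj (i, j, None) (i, j', None).
  have [-> //|neq] := eqVneq j j'.
  by apply: connect1; rewrite /= eqxx neq.
move=> [[i j] o] [[i' j'] o'].
apply: connect_trans (to_core i j o) _.
apply: connect_trans (core i i' j) _.
rewrite csym; apply: connect_trans (to_core i' j' o') _.
rewrite csym; apply: connect_trans (_ : connect _ _ (i', j, None)) _.
  by rewrite csym.
exact: connect_trans (hub i' j j') _.
Qed.

Let core (ij : 'I_k * 'I_p) (xs : 'I_k * bool) : ext_vertex := (ij, Some xs).

Let card_coreC ij xs : #|core ij @: [set~ xs]| = 2 * k - 1.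
Proof.
rewrite card_imset => [|xs1 xs2 []//].
by rewrite cardsC1 card_prod card_ord card_bool mulnC subn1.
Qed.

Lemma deg_hub i j : deg ext_adj (i, j, None) = p - 1 + (2 * k - 1).
Proof.
pose hub j' : ext_vertex := (i, j', None).
have -> : p - 1 = #|hub @: [set~ j]|.
  by rewrite card_imset => [|j1 j2 []//]; rewrite cardsC1 card_ord subn1.
rewrite -(card_coreC (i, j) (i, true)) /deg -cardsUI.
rewrite [X in _ + X]eq_card0 ?addn0 => [|a]; last first.
  by rewrite !inE; apply/negP=> /andP[/imsetP[? _ ->] /imsetP[? _ []]].
apply: eq_card => -[[i' j'] [xs|]]; rewrite !inE /=.
  apply/and3P/orP=> [[/eqP<- /eqP<- neq]|[/imsetP[]//|/imsetP[xs' neq [-> -> ->]]]].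
    by right; apply: imset_f; rewrite !inE.
  by move: neq; rewrite !inE.
apply/andP/orP=> [[/eqP<- neq]|[/imsetP[j1 neq [-> ->]]|/imsetP[]//]].
  by left; apply: imset_f; rewrite !inE eq_sym.
by move: neq; rewrite !inE eq_sym.
Qed.

Lemma deg_core_ge ij xs : 2 * k - 1 <= deg ext_adj (ij, Some xs).
Proof.
rewrite -(card_coreC ij xs); apply/subset_leq_card/subsetP=> _ /imsetP[xs' neq ->].
by case: ij => i j; move: neq; rewrite !inE /= !eqxx eq_sym => ->.
Qed.

(** The neighbours are at most one hub, [2 * k - 1] core vertices and [k - 1] links. *)
Lemma deg_core_le ij xs : deg ext_adj (ij, Some xs) <= 3 * k - 1.
Proof.
case: ij => i j; have k0 : 0 < k := leq_ltn_trans (leq0n i) (ltn_ord i).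
pose link i' : ext_vertex := (i', j, Some (i', false)).
have sub : nbhd ext_adj (i, j, Some xs) \subset
    (i, j, None) |: (core (i, j) @: [set~ xs] :|: link @: [set~ i]).
  apply/subsetP=> -[[i' j'] [xs'|]]; rewrite !inE /=; last first.
    by case/and3P=> /eqP-> /eqP-> _; rewrite eqxx.
  case/orP=> [/andP[/andP[/eqP<- /eqP<-] neq]|/and4P[neq /eqP<- _ /eqP->]].
    by apply/or3P; apply: Or32; apply: (imset_f (core (i, j))); rewrite !inE eq_sym.
  by apply/or3P; apply: Or33; apply: (imset_f link); rewrite !inE eq_sym.
apply: leq_trans (subset_leq_card sub) _.
rewrite cardsU1; apply: leq_trans (leq_add (leq_b1 _) (leq_card_setU _ _).1) _.
rewrite card_coreC card_imset => [|i1 i2 []//]; rewrite cardsC1 card_ord; lia.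
Qed.

(** This vertex has neither its hub nor any link as a neighbour, and so realises the minimum
    degree. *)
Lemma deg_core_off_hub i j : deg ext_adj (i, j, Some (i, true)) = 2 * k - 1.
Proof.
apply/eqP; rewrite eqn_leq deg_core_ge andbT -(card_coreC (i, j) (i, true)).
apply/subset_leq_card/subsetP=> -[[i' j'] [xs'|]]; rewrite !inE /=; last first.
  by case/and3P=> /eqP-> _; rewrite eqxx.
case/orP=> [/andP[/andP[/eqP<- /eqP<-] neq]|/and4P[_ _ /eqP[]//]].
by apply: (imset_f (core (i, j))); rewrite !inE eq_sym.
Qed.

Lemma ext_colour_surj (j0 : 'I_p) c : exists a, ext_colour a = c.
Proof.
case: c => i [j|]; first by exists (i, j, None).
by exists (i, j0, Some (i, true)).
Qed.

(** A hub class with index [i] is invisible from [(i, j0, Some (i, true))]; the class [(i, None)]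
    meets the closed neighbourhood of the hub [(i, j0, None)] only in [(i, false)]. *)
Lemma ext_not_dom (j0 : 'I_p) c :
  ~~ double_dom ext_adj (ext_colour @^-1: [set c]).
Proof.
case: c => i [j|]; apply/forallPn.
  exists (i, j0, Some (i, true)); rewrite -ltnNge [X in X < _]eq_card0 //.
  case=> [[i' j'] [[x s]|]]; rewrite !inE /=; first by apply/negP=> /andP[_ /eqP[]].
  by apply/negP=> /andP[/orP[/eqP[]//|/and3P[/eqP-> _]]]; rewrite eqxx.
exists (i, j0, None); rewrite -ltnNge ltnS.
rewrite -(cards1 (core (i, j0) (i, false))).
apply/subset_leq_card/subsetP=> -[[i' j'] [[x s]|]]; rewrite !inE /=; last first.
  by case/andP=> _ /eqP[].
case/andP=> /orP[/eqP[]//|/and3P[/eqP<- /eqP<- neq]] /eqP[Ex]; move: neq.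
by rewrite Ex; case: s; rewrite ?eqxx.
Qed.

Lemma ext_pair_dom i j :
  double_dom ext_adj (ext_colour @^-1: [set (i, None)] :|:
                      ext_colour @^-1: [set (i, Some j)]).
Proof.
apply/forallP=> a; apply/card_gt1P.
case: a => [[i' j'] o].
(* Only the hubs with index [i] miss a vertex of [(i, None)] in their core; for them the hub
   [(i, j)], equal or adjacent, is the second vertex. *)
case: (boolP ((o == None) && (i' == i))) => [/andP[/eqP-> /eqP->]|].
  exists (i, j', Some (i, false)), (i, j, None); split; last by apply/eqP=> -[].
    by rewrite !inE /= !xpair_eqE !eqxx.
  rewrite !inE /= !xpair_eqE !eqxx /= andbT.
  by case: eqVneq.
move=> neq; exists (i', j', Some (i, false)), (i', j', Some (i, true)).
have mem s : (i', j', Some (i, s)) \in cnbhd ext_adj (i', j', o) :&: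
    (ext_colour @^-1: [set (i, None)] :|: ext_colour @^-1: [set (i, Some j)]).
  rewrite !inE /= !eqxx /= andbT.
  case: o neq => [xs|] /= neq; first by have [->|] := eqVneq xs (i, s); rewrite ?eqxx ?orbT.
  by rewrite [(i, s) == _]xpair_eqE negb_and [i == _]eq_sym neq orbT.
by split=> //; apply/eqP=> -[].
Qed.

End Extremal.

(** * Sharpness for odd minimum degree *)

Lemma dc_bound_attained (d : nat) : odd d -> 3 <= d ->
  exists (n : nat) (e : rel 'I_n),
    [/\ simple_graph e, connected_graph e, mindeg e = d,
        4 * uphalf d - 3 <= maxdeg e & DC e = dc_bound d (maxdeg e)].
Proof.
(* This [p] gives the hubs degree [p - 1 + (2 * k - 1) = 4 * k - 3], the least maximum degree
   allowed; core degrees stay below it because [3 * k - 1 <= 4 * k - 3] for [k >= 2]. *)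
move=> odd_d d3; pose k := uphalf d; pose p := 2 * k - 1.
have dk : d = 2 * k - 1 by rewrite /k; lia.
have k2 : 2 <= k by lia.
have p1 : 0 < p by rewrite /p; lia.
have k0 : 0 < k by lia.
pose i0 : 'I_k := Ordinal k0; pose j0 : 'I_p := Ordinal p1.
pose V := ext_vertex k p; pose g : 'I_#|V| -> V := enum_val.
have bij_g : bijective g := @enum_val_bij V.
pose e := relpre g (@ext_adj k p).
have [h gK hK] := bij_g.
have simple_e : simple_graph e.
  by split=> [x y | x]; rewrite /e /= ?ext_adj_irr // ext_adj_sym.
have conn_e : connected_graph e.
  by apply: connected_relpre bij_g _; exact: ext_connected.
have deg_e x : deg e x = deg (@ext_adj k p) (g x) by exact: deg_relpre.
have deg_ge x : d <= deg e x.
  rewrite deg_e dk; case: (g x) => [[i j] [xs|]]; first exact: deg_core_ge.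
  by rewrite deg_hub leq_addl.
have mind : mindeg e = d.
  apply/eqP; rewrite eqn_leq; apply/andP; split.
    apply: leq_trans (mindeg_le _ (h (i0, j0, Some (i0, true)))) _.
    by rewrite deg_e hK deg_core_off_hub dk.
  apply: le_mindeg => //.
  exact: leq_trans (deg_ge (h (i0, j0, None))) (max_card _).
have maxd : maxdeg e = 4 * k - 3.
  apply/eqP; rewrite eqn_leq; apply/andP; split.
    apply/bigmax_leqP=> x _; rewrite deg_e.
    case: (g x) => [[i j] [xs|]]; last by rewrite deg_hub /p; lia.
    by apply: leq_trans (deg_core_le _ _) _; lia.
  apply: leq_trans (leq_bigmax (h (i0, j0, None))).
  by rewrite deg_e hK deg_hub /p; lia.
exists #|V|, e; split=> //; first by rewrite maxd.
apply/eqP; rewrite eqn_leq; apply/andP; split.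
  by rewrite -mind; apply: DC_le => //; rewrite mind ?maxd //; lia.
(* Since [d] is odd, [1 + d./2 = k], so the bound is [k * p + k], the number of colours. *)
have -> : dc_bound d (maxdeg e) = #|{: 'I_k * option 'I_p}|.
  rewrite maxd /dc_bound -/k card_prod card_option !card_ord.
  have -> : 4 * k - 3 + 2 - 2 * k = p by rewrite /p; lia.
  by rewrite mulnS; lia.
have pre c : (@ext_colour k p \o g) @^-1: [set c] =
    g @^-1: (@ext_colour k p @^-1: [set c]) by apply/setP=> x; rewrite !inE.
apply: (@colouring_le_DC _ _ _ (@ext_colour k p \o g)) => c.
- have [a <-] := ext_colour_surj j0 c.
  by exists (h a); rewrite /= hK.
- by rewrite pre double_dom_relpre // ext_not_dom.
- case: c => i [j|].
    exists (i, None); [by apply/eqP=> -[] | rewrite !pre -preimsetU double_dom_relpre // setUC].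
    exact: ext_pair_dom.
  exists (i, Some j0); [by apply/eqP=> -[] | rewrite !pre -preimsetU double_dom_relpre //].
  exact: ext_pair_dom.
Qed.

Theorem theorem4p1 :
  (forall (T : finType) (e : rel T),
     simple_graph e -> connected_graph e ->
     1 <= mindeg e ->
     4 * uphalf (mindeg e) - 3 <= maxdeg e ->
     DC e <= dc_bound (mindeg e) (maxdeg e))
  /\
  (forall d : nat, odd d -> 3 <= d ->
     exists (n : nat) (e : rel 'I_n),
       [/\ simple_graph e, connected_graph e, mindeg e = d,
           4 * uphalf d - 3 <= maxdeg e
         & DC e = dc_bound d (maxdeg e)]).
Proof.
by split=> [T e simple_e _ | d]; [exact: DC_le | exact: dc_bound_attained].
Qed.
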